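(* For $c_1,c_2\in\mathbb{C}$, the partial differential system in two variables $(t,s)$ $$\begin{aligned} dx=&\left\{-\tfrac32(\sqrt5-1)x^2+y\right\}dt+\left\{-12(\sqrt5+2)x^2y+(\sqrt5+1)\left(3xz-2y^2-\tfrac23\delta\right)\right\}ds,\\ dy=&\;z\,dt+\left\{-6(2\sqrt5-5)x^2z+12\sqrt5\,xy^2-(\sqrt5+1)yz+(3\sqrt5-5)\delta x\right\}ds,\\ dz=&\left\{3(\sqrt5+3)y^2+3(\sqrt5-1)xz+\delta\right\}dt+\left\{48xyz-24y^3-(\sqrt5+1)z^2+2(\sqrt5-3)\delta y\right\}ds \end{aligned}$$ with $\delta=\frac34(\sqrt5-3)c_2^4$ admits the travelling wave solution $$x=\frac{c_2}{\sqrt{3(\sqrt5+1)}}\tanh\left(\sqrt{\tfrac32(\sqrt5-2)}\;c_2t+\sqrt{3(\sqrt5+1)}\;c_2^3s+c_1\right),\qquad y=-\frac14(\sqrt5-3)c_2^2,\qquad z=0 .$$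
   Context: Here $x,y,z$ are unknown complex functions of $(t,s)$; the coefficient of $dt$ (resp. $ds$) in $dx,dy,dz$ prescribes the partial derivatives of $x,y,z$ with respect to $t$ (resp. $s$). Square roots of positive real numbers are the positive ones. *)

(* Defs.v *)
From Stdlib Require Import Reals.
From Coquelicot Require Export Coquelicot.

Open Scope C_scope.

Definition Cexp (w : C) : C := exp (Re w) * (cos (Im w) + Ci * sin (Im w)).

Definition Csinh (w : C) : C := (Cexp w - Cexp (- w)) / 2.

Definition Ccosh (w : C) : C := (Cexp w + Cexp (- w)) / 2.

(** Meaningful only where [Ccosh w <> 0]: division in [C] is total, so
    [Ctanh] takes a junk value at the poles. *)
Definition Ctanh (w : C) : C := Csinh w / Ccosh w.

(** The typing of [f] matters: the source is [C] as a normed module over itself,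
    so this is the complex (not the real) derivative. *)
Definition is_C_derive (f : C -> C) (w l : C) : Prop :=
  @is_derive C_AbsRing C_NormedModule f w l.

Definition is_partial_t (u : C -> C -> C) (t s l : C) : Prop :=
  is_C_derive (fun t' => u t' s) t l.

Definition is_partial_s (u : C -> C -> C) (t s l : C) : Prop :=
  is_C_derive (fun s' => u t s') s l.

(** [du = a dt + b ds] at [(t, s)], read as prescribing the two partial
    derivatives of [u]. *)
Definition has_partials (u : C -> C -> C) (t s a b : C) : Prop :=
  is_partial_t u t s a /\ is_partial_s u t s b.

Definition solves_system (delta : C) (D : C -> C -> Prop)
    (x y z : C -> C -> C) : Prop :=
  forall t s : C, D t s ->
    let q : C := sqrt 5 in
    let X := x t s in
    let Y := y t s in
    let Z := z t s in
    has_partials x t s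
      (- (3 / 2) * (q - 1) * X ^ 2 + Y)
      (- 12 * (q + 2) * X ^ 2 * Y
       + (q + 1) * (3 * X * Z - 2 * Y ^ 2 - 2 / 3 * delta))
    /\
    has_partials y t s
      Z
      (- 6 * (2 * q - 5) * X ^ 2 * Z + 12 * q * X * Y ^ 2
       - (q + 1) * Y * Z + (3 * q - 5) * delta * X)
    /\
    has_partials z t s
      (3 * (q + 3) * Y ^ 2 + 3 * (q - 1) * X * Z + delta)
      (48 * X * Y * Z - 24 * Y ^ 3 - (q + 1) * Z ^ 2
       + 2 * (q - 3) * delta * Y).

(* Main.v *)
Require Import Defs.
From Stdlib Require Import Reals Lra.
From Coquelicot Require Import Coquelicot.
Open Scope C_scope.

(** Along the wave [z] vanishes, [y] is constant and [x] is a multiple of [tanh]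
    of an affine phase.  Since [tanh' = 1 - tanh ^ 2], both partial derivatives
    of [x] are polynomials of degree at most two in [T = tanh], and so are all
    six right-hand sides; the system therefore reduces to polynomial identities in [T] and [c2], with
    coefficients in the field generated by [q = sqrt 5] and the two radicals
    [a = sqrt (3/2 (q - 2))] and [b = sqrt (3 (q + 1))].  The radicals occur
    only through [b / b], [1 / b ^ 2] and [a / b], and these lie in [Q(q)]:
    [1 / b ^ 2 = (q - 1) / 12] because [(q - 1) (q + 1) = 4], and
    [a / b = (3 - q) / 4] because [a b = 3/2 (q - 1)]
    ([wave_numbers_mult], the one place where the relative sign of the two
    radicals enters).  The identities then follow from [q ^ 2 = 5].

    The analytic input is the complex derivative of [tanh]
    ([is_C_derive_tanh]).  It is obtained from the derivatives of the
    exponential and of the inverse by the product and chain rules.  These two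
    derivatives come from one criterion, [is_C_derive_quadratic]: a
    linearisation error that is quadratic in the increment is enough.  For the
    exponential the functional equation moves the estimate to the origin,
    where [exp], [cos] and [sin] of the real and imaginary parts are bounded
    separately. *)

(** * Complex differentiation *)

Lemma Cmod_le_Re_Im (z : C) : (Cmod z <= Rabs (Re z) + Rabs (Im z))%R.
Proof.
  destruct z as [a b].
  replace (a, b) with (RtoC a + Ci * RtoC b)
    by (apply injective_projections; simpl; ring).
  eapply Rle_trans; [apply Cmod_triangle|].
  rewrite Cmod_mult, !Cmod_R.
  replace (Cmod Ci) with 1%R.
  - simpl. rewrite !Rmult_0_l, !Rmult_1_l, !Rplus_0_l, !Rminus_0_r, Rplus_0_r.
    lra.
  - unfold Cmod, Ci; simpl.
    rewrite <- sqrt_1 at 1. f_equal. ring.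
Qed.

Lemma Rabs_Re_le (z : C) : (Rabs (Re z) <= Cmod z)%R.
Proof.
  eapply Rle_trans; [apply Rmax_l|apply (Rmax_Cmod z)].
Qed.

Lemma Rabs_Im_le (z : C) : (Rabs (Im z) <= Cmod z)%R.
Proof.
  eapply Rle_trans; [apply Rmax_r|apply (Rmax_Cmod z)].
Qed.

(** [C] carries two normed-module structures over itself, with the box and the
    disc uniformities.  Differentiability only sees the norm, which they share;
    passing to the second one makes the general product and chain rules apply,
    as these take functions valued in the base ring. *)
Lemma is_C_derive_AbsRing (f : C -> C) (w l : C) :
  @is_derive C_AbsRing (AbsRing_NormedModule C_AbsRing) f w l <->
  is_C_derive f w l.
Proof.
  split; intros [[H1 H2 H3] H4]; (split; [split|]); assumption.
Qed.

(** A remainder bounded by [M * Cmod h ^ 2] is at most [eps * Cmod h] as soon as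
    [M * Cmod h <= eps]. *)
Lemma is_C_derive_quadratic (f : C -> C) (w l : C) (M r : R) :
  (0 < r)%R ->
  (forall h : C, (Cmod h < r)%R ->
     (Cmod (f (w + h) - f w - h * l)%C <= M * Cmod h ^ 2)%R) ->
  is_C_derive f w l.
Proof.
  intros Hr H. apply is_C_derive_AbsRing. split.
  - apply is_linear_scal_l.
  - intros x Hx.
    apply (is_filter_lim_locally_unique (K := C_AbsRing)
             (V := AbsRing_NormedModule C_AbsRing)) in Hx.
    subst x.
    intros eps.
    (* The sign of M is unknown, and eps is to be divided by the constant. *)
    set (M' := (Rabs M + 1)%R).
    assert (HM : (0 < M')%R) by (unfold M'; generalize (Rabs_pos M); lra).
    assert (Hd : (0 < Rmin r (eps / M'))%R).
    { apply Rmin_pos; [exact Hr|]. apply Rdiv_lt_0_compat; [apply eps|exact HM]. }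
    exists (mkposreal _ Hd). intros y Hy.
    change (Cmod (y - w)%C < Rmin r (eps / M'))%R in Hy.
    change (Cmod (f y - f w - (y - w) * l)%C <= eps * Cmod (y - w)%C)%R.
    set (h := y - w) in *.
    replace y with (w + h) by (unfold h; ring).
    eapply Rle_trans.
    { apply H. eapply Rlt_le_trans; [exact Hy|apply Rmin_l]. }
    assert (Hh : (M' * Cmod h <= eps)%R).
    { assert (Cmod h < eps / M')%R
        by (eapply Rlt_le_trans; [exact Hy|apply Rmin_r]).
      apply Rmult_lt_compat_l with (r := M') in H0; [|exact HM].
      replace (M' * (eps / M'))%R with (pos eps) in H0 by (field; lra). lra. }
    generalize (Cmod_ge_0 h) (Rle_abs M). intros H0 H1. unfold M' in Hh.
    apply Rle_trans with ((Rabs M + 1) * Cmod h * Cmod h)%R.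
    + replace ((Rabs M + 1) * Cmod h * Cmod h)%R
        with ((Rabs M + 1) * Cmod h ^ 2)%R by ring.
      apply Rmult_le_compat_r; [apply pow2_ge_0|lra].
    + apply Rmult_le_compat_r; lra.
Qed.

Lemma is_C_derive_mult (f g : C -> C) (w df dg : C) :
  is_C_derive f w df -> is_C_derive g w dg ->
  is_C_derive (fun v => f v * g v) w (df * g w + f w * dg).
Proof.
  intros Hf Hg. apply is_C_derive_AbsRing in Hf, Hg.
  apply is_C_derive_AbsRing.
  apply (@is_derive_mult C_AbsRing f g w df dg Hf Hg).
  intros n m. apply Cmult_comm.
Qed.

Lemma is_C_derive_comp (f g : C -> C) (w df dg : C) :
  is_C_derive f (g w) df -> is_C_derive g w dg ->
  is_C_derive (fun v => f (g v)) w (dg * df).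
Proof.
  intros Hf Hg. apply is_C_derive_AbsRing in Hg.
  exact (@is_derive_comp C_AbsRing C_NormedModule f g w df dg Hf Hg).
Qed.

Lemma is_C_derive_affine (a b w : C) : is_C_derive (fun v => a * v + b) w a.
Proof.
  apply (is_C_derive_quadratic _ _ _ 0 1); [lra|].
  intros h _.
  replace (a * (w + h) + b - (a * w + b) - h * a) with (RtoC 0) by ring.
  rewrite Cmod_0. lra.
Qed.

(** The linearisation error is exactly [h ^ 2 / (w ^ 2 (w + h))], and [w + h]
    stays at distance at least [Cmod w / 2] from [0] when
    [Cmod h < Cmod w / 2]. *)
Lemma is_C_derive_inv (w : C) : w <> 0 -> is_C_derive Cinv w (- / (w * w)).
Proof.
  intros Hw.
  assert (Hm : (0 < Cmod w)%R) by (apply Cmod_gt_0, Hw).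
  apply (is_C_derive_quadratic _ _ _ (2 / Cmod w ^ 3) (Cmod w / 2)); [lra|].
  intros h Hh.
  assert (Hwh : (Cmod w / 2 < Cmod (w + h)%C)%R).
  { assert (Cmod w <= Cmod (w + h)%C + Cmod h)%R.
    { replace w with ((w + h) + - h) at 1 by ring.
      eapply Rle_trans; [apply Cmod_triangle|]. rewrite Cmod_opp. lra. }
    lra. }
  assert (Hnz : w + h <> 0) by (apply Cmod_gt_0; lra).
  replace (/ (w + h) - / w - h * - / (w * w)) with (h * h / (w * w * (w + h)))
    by (field; split; assumption).
  rewrite Cmod_div by (repeat apply Cmult_neq_0; assumption).
  rewrite !Cmod_mult.
  replace (2 / Cmod w ^ 3 * Cmod h ^ 2)%R
    with (Cmod h * Cmod h * / (Cmod w * Cmod w * (Cmod w / 2)))%R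
    by (field; lra).
  unfold Rdiv at 1.
  apply Rmult_le_compat_l; [generalize (Cmod_ge_0 h); nra|].
  apply Rinv_le_contravar; [|apply Rmult_le_compat_l; nra].
  repeat apply Rmult_lt_0_compat; lra.
Qed.

(** * The complex exponential and the hyperbolic tangent *)

Lemma Cexp_plus (v w : C) : Cexp (v + w) = Cexp v * Cexp w.
Proof.
  destruct v as [a b], w as [a' b'].
  unfold Cexp; simpl. rewrite exp_plus, cos_plus, sin_plus.
  apply injective_projections; simpl; ring.
Qed.

(** Both bounds come from the convexity inequality [1 + x <= exp x]: at [x = a]
    it is the lower one, at [x = - a] it gives [exp a <= 1 / (1 - a)], hence an
    excess of at most [a ^ 2 / (1 - a)]. *)
Lemma exp_quadratic (a : R) :
  (Rabs a <= 1 / 2 -> 0 <= exp a - 1 - a <= 2 * a ^ 2)%R.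
Proof.
  intros Ha. apply Rabs_le_between in Ha.
  generalize (exp_ineq1_le a) (exp_ineq1_le (- a)) (exp_pos a). intros H1 H2 H3.
  split; [lra|].
  assert (H4 : (exp a * exp (- a) = 1)%R).
  { rewrite <- exp_plus, Rplus_opp_r. apply exp_0. }
  assert (H5 : (exp a * (1 - a) <= 1)%R) by nra.
  nra.
Qed.

Lemma Rabs_sin_le (b : R) : (Rabs (sin b) <= Rabs b)%R.
Proof.
  destruct (MVT_gen sin 0 b cos) as [c [_ Hc]].
  - intros; apply is_derive_sin.
  - intros; apply continuity_sin.
  - rewrite sin_0, !Rminus_0_r in Hc. rewrite Hc, Rabs_mult.
    rewrite <- (Rmult_1_l (Rabs b)) at 2.
    apply Rmult_le_compat_r; [apply Rabs_pos|].
    apply Rabs_le, COS_bound.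
Qed.

(** Half-angle formula: [1 - cos b = 2 (sin (b / 2)) ^ 2 <= b ^ 2 / 2]. *)
Lemma cos_quadratic (b : R) : (Rabs (cos b - 1) <= b ^ 2)%R.
Proof.
  replace b with (2 * (b / 2))%R at 1 by field.
  rewrite cos_2a_sin.
  generalize (Rabs_sin_le (b / 2)). intros H.
  apply Rsqr_le_abs_1 in H. unfold Rsqr in H.
  apply Rabs_le. nra.
Qed.

(** The mean value theorem writes [sin b - b] as [(cos c - 1) * b] with [c]
    between [0] and [b]; only a quadratic bound is wanted, so one factor [b] is
    given away. *)
Lemma sin_quadratic (b : R) : (Rabs b <= 1 -> Rabs (sin b - b) <= b ^ 2)%R.
Proof.
  intros Hb.
  destruct (MVT_gen (fun x => sin x - x)%R 0 b (fun x => cos x - 1)%R)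
    as [c [Hc1 Hc]].
  - intros. auto_derive; [trivial|ring].
  - intros x _. apply continuity_pt_minus; [apply continuity_sin|].
    apply derivable_continuous_pt, derivable_pt_id.
  - rewrite sin_0, !Rminus_0_r in Hc. rewrite Hc, Rabs_mult.
    assert (Hcb : (Rabs c <= Rabs b)%R).
    { revert Hc1. unfold Rmin, Rmax, Rabs.
      repeat destruct Rle_dec; repeat destruct Rcase_abs; lra. }
    generalize (cos_quadratic c) (Rabs_pos c). intros H1 H2.
    rewrite <- (pow2_abs b). rewrite <- (pow2_abs c) in H1.
    apply Rle_trans with (Rabs b * Rabs b)%R; [|lra].
    apply Rmult_le_compat_r; [lra|]. nra.
Qed.

(** With [h = a + i b], the identity
    [e^h - 1 - h = (e^a - 1) (e^(ib) - 1) + (e^a - 1 - a) + (e^(ib) - 1 - i b)]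
    splits the error into a product of two first-order terms and two real
    second-order remainders. *)
Lemma Cexp_quadratic (h : C) :
  (Cmod h < 1 / 2 -> Cmod (Cexp h - 1 - h)%C <= 10 * Cmod h ^ 2)%R.
Proof.
  intros Hh.
  generalize (Rabs_Re_le h) (Rabs_Im_le h) (Cmod_ge_0 h).
  set (m := Cmod h) in *. destruct h as [a b]. simpl Re; simpl Im.
  intros Ha Hb Hm.
  assert (HE : (0 <= exp a - 1 - a <= 2 * a ^ 2)%R)
    by (apply exp_quadratic; lra).
  assert (HC := cos_quadratic b).
  assert (HS : (Rabs (sin b - b) <= b ^ 2)%R) by (apply sin_quadratic; lra).
  assert (Hs := Rabs_sin_le b).
  assert (Ha2 : (a ^ 2 <= m ^ 2)%R)
    by (rewrite <- pow2_abs; generalize (Rabs_pos a); nra).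
  assert (Hb2 : (b ^ 2 <= m ^ 2)%R)
    by (rewrite <- pow2_abs; generalize (Rabs_pos b); nra).
  assert (HE1 : (Rabs (exp a - 1) <= 2 * m)%R).
  { replace (exp a - 1)%R with (a + (exp a - 1 - a))%R by ring.
    eapply Rle_trans; [apply Rabs_triang|].
    rewrite (Rabs_pos_eq (exp a - 1 - a)) by lra. nra. }
  eapply Rle_trans; [apply Cmod_le_Re_Im|].
  replace (Re (Cexp (a, b) - 1 - (a, b)))
    with ((exp a - 1) * (cos b - 1) + (exp a - 1 - a) + (cos b - 1))%R
    by (simpl; ring).
  replace (Im (Cexp (a, b) - 1 - (a, b)))
    with ((exp a - 1) * sin b + (sin b - b))%R by (simpl; ring).
  assert (H1 : (Rabs ((exp a - 1) * (cos b - 1)) <= 2 * m * m ^ 2)%R).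
  { rewrite Rabs_mult. apply Rmult_le_compat; try apply Rabs_pos; lra. }
  assert (H2 : (Rabs ((exp a - 1) * sin b) <= 2 * m * m)%R).
  { rewrite Rabs_mult. apply Rmult_le_compat; try apply Rabs_pos; lra. }
  assert (H3 : (m * m ^ 2 <= m ^ 2)%R) by (assert (0 <= m ^ 2)%R by nra; nra).
  assert (H4 : (Rabs (exp a - 1 - a) <= 2 * m ^ 2)%R)
    by (rewrite Rabs_pos_eq; lra).
  generalize (Rabs_triang ((exp a - 1) * (cos b - 1) + (exp a - 1 - a))
                (cos b - 1))
    (Rabs_triang ((exp a - 1) * (cos b - 1)) (exp a - 1 - a))
    (Rabs_triang ((exp a - 1) * sin b) (sin b - b)).
  nra.
Qed.

Lemma is_C_derive_exp (w : C) : is_C_derive Cexp w (Cexp w).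
Proof.
  apply (is_C_derive_quadratic _ _ _ (Cmod (Cexp w) * 10) (1 / 2)); [lra|].
  intros h Hh. rewrite Cexp_plus.
  replace (Cexp w * Cexp h - Cexp w - h * Cexp w)
    with (Cexp w * (Cexp h - 1 - h)) by ring.
  rewrite Cmod_mult, Rmult_assoc.
  apply Rmult_le_compat_l; [apply Cmod_ge_0|].
  apply Cexp_quadratic, Hh.
Qed.

(** Covers [sinh] and [cosh] at once. *)
Lemma is_C_derive_exp_combination (a b w : C) :
  is_C_derive (fun v => a * Cexp v + b * Cexp (- v)) w
    (a * Cexp w - b * Cexp (- w)).
Proof.
  assert (Hneg : is_C_derive (fun v => Cexp (- v)) w (- (1) * Cexp (- w))).
  { apply (is_C_derive_comp Cexp (fun v => - v)); [apply is_C_derive_exp|].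
    apply (is_derive_ext (K := C_AbsRing) (V := C_NormedModule)
             (fun v => - (1) * v + 0)).
    - intros v. change (- (1) * v + 0 = - v). ring.
    - apply is_C_derive_affine. }
  replace (a * Cexp w - b * Cexp (- w))
    with ((0 * Cexp w + a * Cexp w) + (0 * Cexp (- w) + b * (- (1) * Cexp (- w))))
    by ring.
  apply (is_derive_plus (K := C_AbsRing) (V := C_NormedModule)).
  - apply (is_C_derive_mult (fun _ => a) Cexp); [|apply is_C_derive_exp].
    apply (is_derive_const (K := C_AbsRing) (V := C_NormedModule)).
  - apply (is_C_derive_mult (fun _ => b) (fun v => Cexp (- v))); [|exact Hneg].
    apply (is_derive_const (K := C_AbsRing) (V := C_NormedModule)).
Qed.

Lemma is_C_derive_sinh (w : C) : is_C_derive Csinh w (Ccosh w).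
Proof.
  replace (Ccosh w) with (/ 2 * Cexp w - - / 2 * Cexp (- w))
    by (unfold Ccosh; field).
  apply (is_derive_ext (K := C_AbsRing) (V := C_NormedModule)
           (fun v => / 2 * Cexp v + - / 2 * Cexp (- v))).
  - intros v. change (/ 2 * Cexp v + - / 2 * Cexp (- v) = Csinh v).
    unfold Csinh. field.
  - apply is_C_derive_exp_combination.
Qed.

Lemma is_C_derive_cosh (w : C) : is_C_derive Ccosh w (Csinh w).
Proof.
  replace (Csinh w) with (/ 2 * Cexp w - / 2 * Cexp (- w))
    by (unfold Csinh; field).
  apply (is_derive_ext (K := C_AbsRing) (V := C_NormedModule)
           (fun v => / 2 * Cexp v + / 2 * Cexp (- v))).
  - intros v. change (/ 2 * Cexp v + / 2 * Cexp (- v) = Ccosh v).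
    unfold Ccosh. field.
  - apply is_C_derive_exp_combination.
Qed.

Lemma is_C_derive_tanh (w : C) :
  Ccosh w <> 0 -> is_C_derive Ctanh w (1 - Ctanh w ^ 2).
Proof.
  intros Hw.
  replace (1 - Ctanh w ^ 2)
    with (Ccosh w * / Ccosh w
          + Csinh w * (Csinh w * - / (Ccosh w * Ccosh w)))
    by (unfold Ctanh; field; exact Hw).
  apply (is_C_derive_mult Csinh (fun v => / Ccosh v)).
  - apply is_C_derive_sinh.
  - apply (is_C_derive_comp Cinv Ccosh).
    + apply is_C_derive_inv, Hw.
    + apply is_C_derive_cosh.
Qed.

(** * The travelling wave *)

Lemma is_C_derive_tanh_wave (p : C -> C) (A k b v : C) :
  (forall v', p v' = k * v' + b) -> Ccosh (p v) <> 0 ->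
  is_C_derive (fun v' => A * Ctanh (p v')) v (A * k * (1 - Ctanh (p v) ^ 2)).
Proof.
  intros Hp Hc.
  replace (A * k * (1 - Ctanh (p v) ^ 2))
    with (0 * Ctanh (p v) + A * (k * (1 - Ctanh (p v) ^ 2))) by ring.
  apply (is_C_derive_mult (fun _ => A) (fun v' => Ctanh (p v'))).
  - apply (is_derive_const (K := C_AbsRing) (V := C_NormedModule)).
  - apply (is_C_derive_comp Ctanh p).
    + apply is_C_derive_tanh, Hc.
    + apply (is_derive_ext (K := C_AbsRing) (V := C_NormedModule)
               (fun v' => k * v' + b)).
      * intros v'. symmetry. apply Hp.
      * apply is_C_derive_affine.
Qed.

Lemma sqrt5_bounds : (2 < sqrt 5 < 3)%R.
Proof.
  generalize (sqrt_sqrt 5 ltac:(lra)) (sqrt_pos 5). intros H1 H2. nra.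
Qed.

(** With [q = sqrt 5], the product of the radicands is
    [9/2 (3 - q) = (3/2 (q - 1)) ^ 2], and [q > 1] fixes the sign of the root. *)
Lemma wave_numbers_mult :
  (sqrt (3 / 2 * (sqrt 5 - 2)) * sqrt (3 * (sqrt 5 + 1))
   = 3 / 2 * (sqrt 5 - 1))%R.
Proof.
  generalize sqrt5_bounds (sqrt_sqrt 5 ltac:(lra)). intros Hq H5.
  rewrite <- sqrt_mult by lra.
  apply sqrt_lem_1; nra.
Qed.

Theorem proposition10p3 (c1 c2 : C) :
  let delta : C := 3 / 4 * (sqrt 5 - 3) * c2 ^ 4 in
  let phase : C -> C -> C := fun t s =>
    sqrt (3 / 2 * (sqrt 5 - 2)) * c2 * t
    + sqrt (3 * (sqrt 5 + 1)) * c2 ^ 3 * s + c1 in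
  solves_system delta
    (fun t s => Ccosh (phase t s) <> 0)
    (fun t s => c2 / sqrt (3 * (sqrt 5 + 1)) * Ctanh (phase t s))
    (fun _ _ => - (1 / 4) * (sqrt 5 - 3) * c2 ^ 2)
    (fun _ _ => 0).
Proof.
  intros delta phase t s Hcosh q X Y Z.
  generalize sqrt5_bounds (sqrt_sqrt 5 ltac:(lra)). intros Hbounds H5.
  assert (Hq : q * q = 5) by (unfold q; rewrite <- RtoC_mult; f_equal; lra).
  set (a := RtoC (sqrt (3 / 2 * (sqrt 5 - 2)))) in *.
  set (b := RtoC (sqrt (3 * (sqrt 5 + 1)))) in *.
  assert (Hb0 : b <> 0).
  { intros H. apply RtoC_inj in H. revert H.
    apply Rgt_not_eq, sqrt_lt_R0. lra. }
  assert (Hbb : b * b = 3 * (q + 1)).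
  { unfold b, q. rewrite <- RtoC_mult, sqrt_sqrt by lra.
    now rewrite RtoC_mult, RtoC_plus. }
  assert (Hab : a * b = 3 / 2 * (q - 1)).
  { unfold a, b, q. rewrite <- RtoC_mult, wave_numbers_mult.
    rewrite RtoC_mult, RtoC_minus, RtoC_div by lra. reflexivity. }
  set (u := / b).
  assert (Hbu : b * u = 1) by (apply Cinv_r, Hb0).
  assert (Huu : u * u = (q - 1) / 12).
  { replace ((q - 1) / 12) with ((q - 1) / 12 * (b * u) * (b * u))
      by (rewrite Hbu; ring).
    replace ((q - 1) / 12 * (b * u) * (b * u))
      with ((q - 1) / 12 * (b * b) * (u * u)) by ring.
    rewrite Hbb.
    replace ((q - 1) / 12 * (3 * (q + 1))) with ((q * q - 1) / 4) by field.
    rewrite Hq. field. }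
  assert (Hau : a * u = (3 - q) / 4).
  { replace (a * u) with ((a * b) * (u * u) + a * u * (1 - b * u)) by ring.
    rewrite Hbu, Hab, Huu.
    replace (3 / 2 * (q - 1) * ((q - 1) / 12) + a * u * (1 - 1))
      with ((q * q - 2 * q + 1) / 8) by field.
    rewrite Hq. field. }
  (* From here on the radicals are opaque: Hbu, Huu and Hau are all that is
     used of their values. *)
  assert (HX : X = c2 * u * Ctanh (phase t s)) by reflexivity.
  assert (HY : Y = (3 - q) / 4 * c2 ^ 2) by (unfold Y; fold q; field).
  assert (Hdelta : delta = 3 / 4 * (q - 3) * c2 ^ 4) by reflexivity.
  assert (HZ : Z = 0) by reflexivity.
  set (T := Ctanh (phase t s)) in *.
  clearbody Z X Y delta.
  assert (Hconst : forall k l v : C, l = 0 -> is_C_derive (fun _ => k) v l).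
  { intros k l v ->.
    apply (is_derive_const (K := C_AbsRing) (V := C_NormedModule)). }
  subst X Y delta Z.
  split; [|split]; split; unfold is_partial_t, is_partial_s.
  - replace (- (3 / 2) * (q - 1) * (c2 * u * T) ^ 2 + (3 - q) / 4 * c2 ^ 2)
      with (c2 * u * (a * c2) * (1 - T ^ 2)).
    + apply (is_C_derive_tanh_wave (fun t' => phase t' s) (c2 * u) (a * c2)
               (b * c2 ^ 3 * s + c1)); [|exact Hcosh].
      intros t'. unfold phase. ring.
    + replace (c2 * u * (a * c2) * (1 - T ^ 2))
        with (a * u * c2 ^ 2 * (1 - T ^ 2)) by ring.
      replace ((c2 * u * T) ^ 2) with (u * u * (c2 * T) ^ 2) by ring.
      rewrite Hau, Huu. field [Hq].
  - match goal with |- is_C_derive _ _ ?l =>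
      replace l with (c2 * u * (b * c2 ^ 3) * (1 - T ^ 2)) end.
    + apply (is_C_derive_tanh_wave (phase t) (c2 * u) (b * c2 ^ 3)
               (a * c2 * t + c1)); [|exact Hcosh].
      intros s'. unfold phase. ring.
    + replace (c2 * u * (b * c2 ^ 3) * (1 - T ^ 2))
        with (b * u * c2 ^ 4 * (1 - T ^ 2)) by ring.
      replace ((c2 * u * T) ^ 2) with (u * u * (c2 * T) ^ 2) by ring.
      rewrite Hbu, Huu. field [Hq].
  - apply Hconst. reflexivity.
  - apply Hconst. field [Hq].
  - apply Hconst. field [Hq].
  - apply Hconst. field [Hq].
Qed.
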